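(* Let $X$ be a compact metric space, let $f:X\to X$ be continuous, and let $\Gamma(f)=\{(x,y)\in X\times X: y=f(x)\}$ be the graph of $f$. Then the closed relation $\Gamma(f)$ is CR-turbulent if and only if $f$ is separated $m$-turbulent for some positive integer $m$.
   Context: $\mathbb{N}$ denotes the positive integers. For a closed relation $F\subset X\times X$ (i.e. a closed subset) and $n\in\mathbb{N}$, $X_F^n=\{(x_1,\dots,x_{n+1})\in X^{n+1}: (x_i,x_{i+1})\in F \text{ for } 1\le i\le n\}$, and $\pi_i$ is the projection to the $i$-th coordinate. $F$ is CR-turbulent if there are $n\in\mathbb{N}$ and two disjoint nonempty closed sets $K,L\subset X_F^n$ such that $\pi_1(K)\cup\pi_1(L)\subset\pi_{n+1}(K)\cap\pi_{n+1}(L)$ (here $\pi_{n+1}$ is the last coordinate). A continuous $f:X\to X$ is separated turbulent if there are disjoint nonempty closed sets $K,L\subset X$ with $K\cup L\subset f(K)\cap f(L)$; $f$ is separated $m$-turbulent if $f^m$ is separated turbulent. *)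

(* Defs.v *)
From HB Require Import structures.
From mathcomp Require Import all_boot all_order all_algebra.
From mathcomp Require Import all_classical all_reals all_analysis.

Set Implicit Arguments.
Unset Strict Implicit.
Unset Printing Implicit Defensive.

Local Open Scope classical_set_scope.

Definition graph (X : Type) (f : X -> X) : set (X * X) :=
  [set p | p.2 = f p.1].

(* The (n + 1)-st power of X, with the product topology. *)
Definition power (X : topologicalType) (n : nat) := {ptws 'I_n.+1 -> X}.

(* Coordinates are numbered from 0: [lift ord0 i] is i + 1. *)
Definition rel_path (X : topologicalType) (F : set (X * X)) (n : nat) :
    set (power X n) :=
  [set x | forall i : 'I_n,
             F (x (widen_ord (leqnSn n) i), x (lift ord0 i))].

Arguments rel_path {X} F n _.

(* [rel_path F n] is coerced to the type of its elements, which carries the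
   subspace topology. *)
Definition path_coord (X : topologicalType) (F : set (X * X)) (n : nat)
    (i : 'I_n.+1) (x : rel_path F n) : X :=
  set_val x i.
Arguments path_coord {X F n} i x.

(* Meant for closed F only; see [closed_graph] below. *)
Definition CR_turbulent (X : topologicalType) (F : set (X * X)) : Prop :=
  exists n : nat, (0 < n)%N /\
  exists K L : set (rel_path F n),
    [/\ closed K /\ closed L, K !=set0 /\ L !=set0, K `&` L = set0 &
        path_coord ord0 @` K `|` path_coord ord0 @` L `<=`
        path_coord ord_max @` K `&` path_coord ord_max @` L].

Definition separated_turbulent (X : topologicalType) (f : X -> X) : Prop :=
  exists K L : set X,
    [/\ closed K /\ closed L, K !=set0 /\ L !=set0, K `&` L = set0 &
        K `|` L `<=` f @` K `&` f @` L].

Definition separated_m_turbulent (X : topologicalType) (m : nat)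
    (f : X -> X) : Prop :=
  separated_turbulent (iter m f).

Lemma closed_graph (R : realType) (X : metricType R) (f : X -> X) :
  continuous f -> closed (graph f).
Proof.
move=> cf [x y] clxy; apply: (@metric_hausdorff R X) => A B yA fxB.
have fB : nbhs x (f @^-1` B) by exact: cf.
have [[a b] [/= gab [/= fa Ab]]] : graph f `&` ((f @^-1` B) `*` A) !=set0.
  by apply: clxy; exists (f @^-1` B, A).
by exists b; split=> //; rewrite (gab : b = f a).
Qed.

(* Main.v *)
Require Import Defs.
From mathcomp Require Import all_boot all_order all_algebra.
From mathcomp Require Import all_classical all_reals all_analysis.

(** A path of length [n] along the graph of [f] is a finite orbit
    [(x, f x, ..., f^n x)], so it is determined by its starting point. Hence
    the first coordinate is a homeomorphism from the path space onto [X]; its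
    inverse is [orbit_path] ([path_coordK], [orbit_pathK]; continuity is
    [path_coord_continuous], [orbit_path_continuous]). Under this
    identification the first coordinate becomes the identity of [X] and the
    last one becomes [f^n], so a pair of closed sets of paths that witnesses
    CR-turbulence at length [n] is the same thing as a pair of closed subsets
    of [X] that witnesses that [f^n] is separated turbulent.

    Closed sets are carried across by taking preimages under the two maps;
    in particular the set of starting points of [K] is closed because it is
    the preimage of [K] under [orbit_path] ([image_path_coord]). *)

Local Open Scope classical_set_scope.

Lemma path_coord_continuous (X : topologicalType) (F : set (X * X)) (n : nat)
    (i : 'I_n.+1) : continuous (@path_coord X F n i).
Proof.
move=> x; apply: (@continuous_comp _ (power X n) X set_val (fun p => p i)).
  exact: initial_continuous.
exact: (@proj_continuous _ (fun=> X) i).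
Qed.

Section GraphPaths.
Context {X : topologicalType} (f : X -> X).

Lemma path_coord_iter n (p : rel_path (graph f) n) (i : 'I_n.+1) :
  path_coord i p = iter i f (path_coord ord0 p).
Proof.
case: i => i; elim: i => [|i IH] ltin.
  by congr path_coord; apply: val_inj.
rewrite /= -(IH (ltnW ltin)).
pose j : 'I_n := Ordinal (ltin : (i < n)%N).
have step : path_coord (lift ord0 j) p =
    f (path_coord (widen_ord (leqnSn n) j) p) by exact: (set_valP p j).
have -> : Ordinal ltin = lift ord0 j by exact: val_inj.
by rewrite step; congr (f (path_coord _ p)); apply: val_inj.
Qed.

Lemma orbit_rel_path n (x : X) :
  rel_path (graph f) n (fun i : 'I_n.+1 => iter i f x).
Proof. by move=> i. Qed.

Definition orbit_path n (x : X) : rel_path (graph f) n :=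
  SigSub (mem_set (orbit_rel_path n x)).

Lemma orbit_pathK n : cancel (orbit_path n) (path_coord ord0).
Proof. by []. Qed.

Lemma path_coordK n : cancel (path_coord ord0) (orbit_path n).
Proof.
move=> p; apply: val_inj; apply/funext => i.
exact: (esym (path_coord_iter n p i)).
Qed.

Lemma iter_continuous n : continuous f -> continuous (iter n f).
Proof.
move=> cf; elim: n => [|n IH] x; first exact: cvg_id.
exact: (@continuous_comp _ _ _ (iter n f) f x (IH x) (cf _)).
Qed.

(** The path space carries the initial topology of the coordinate maps, and
    their composites with [orbit_path] are the continuous iterates of [f]. *)
Lemma orbit_path_continuous n : continuous f -> continuous (orbit_path n).
Proof.
move=> cf; apply: continuous_comp_initial => x.
apply/cvg_sup => i.
apply: (@continuous_comp_initial _ X X (fun p : power X n => p i)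
  (fun y => set_val (orbit_path n y))).
exact: iter_continuous.
Qed.

Lemma image_path_coord n (K : set (rel_path (graph f) n)) (i : 'I_n.+1) :
  path_coord i @` K = iter i f @` (orbit_path n @^-1` K).
Proof.
apply/seteqP; split=> y.
  move=> [p Kp <-]; exists (path_coord ord0 p); first by rewrite /= path_coordK.
  by rewrite [RHS]path_coord_iter.
by move=> [x Kx <-]; exists (orbit_path n x).
Qed.

Lemma preimage_orbit_path_coord n (K : set X) :
  orbit_path n @^-1` (path_coord ord0 @^-1` K) = K.
Proof. by apply/seteqP; split=> x; rewrite /= orbit_pathK. Qed.

(** On starting points the first coordinate acts as [iter 0 f], the identity,
    and the last one as [iter n f]; this turns the inclusion required for
    CR-turbulence into the one required for separated turbulence of
    [iter n f]. *)
Lemma path_turbulence_starting_points n (K L : set (rel_path (graph f) n)) :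
  (path_coord ord0 @` K `|` path_coord ord0 @` L `<=`
   path_coord ord_max @` K `&` path_coord ord_max @` L) =
  (orbit_path n @^-1` K `|` orbit_path n @^-1` L `<=`
   iter n f @` (orbit_path n @^-1` K) `&` iter n f @` (orbit_path n @^-1` L)).
Proof. by rewrite !image_path_coord /= !image_id. Qed.

End GraphPaths.

Theorem theorem3p4 (R : realType) (X : metricType R) (f : X -> X)
    (X_compact : compact [set: X]) (f_cont : continuous f) :
  CR_turbulent (graph f) <->
  exists m : nat, (0 < m)%N /\ separated_m_turbulent m f.
Proof.
split=> -[n [n_gt0 [K [L [[cK cL] [[x Kx] [y Ly]] KL0 KL]]]]]; exists n;
    split=> //.
- have clP := (continuous_closedP _).1 (orbit_path_continuous f n f_cont).
  exists (orbit_path f n @^-1` K), (orbit_path f n @^-1` L); split.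
  + by split; apply: clP.
  + split; first by exists (path_coord ord0 x); rewrite /= path_coordK.
    by exists (path_coord ord0 y); rewrite /= path_coordK.
  + by rewrite -preimage_setI KL0 preimage_set0.
  + by rewrite -path_turbulence_starting_points.
- have clP := (continuous_closedP _).1
    (@path_coord_continuous X (graph f) n ord0).
  exists (path_coord ord0 @^-1` K), (path_coord ord0 @^-1` L); split.
  + by split; apply: clP.
  + by split; [exists (orbit_path f n x) | exists (orbit_path f n y)].
  + by rewrite -preimage_setI KL0 preimage_set0.
  + by rewrite path_turbulence_starting_points !preimage_orbit_path_coord.
Qed.
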